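(* Let $p,n\in\mathbb N$ with $p\ge n\ge 10$, and write $p=k(n-1)+r$ with $k\in\mathbb N$ and $r\in\{0,1,\ldots,n-2\}$. Then $$\mathrm{ex}(p;T_n'')=\frac{(n-2)p-r(n-1-r)}2+\max\Big\{0,\Big\lfloor\frac{r(n-4-r)-3(n-1)}2\Big\rfloor\Big\}.$$
   Context: All graphs are finite simple graphs. For a graph $L$, $\mathrm{ex}(p;L)$ denotes the maximum number of edges in a graph on $p$ vertices that contains no subgraph isomorphic to $L$. For $n\ge 6$, $T_n''$ is the tree on vertex set $\{v_0,\ldots,v_{n-1}\}$ with edge set $\{v_0v_1,v_0v_2,\ldots,v_0v_{n-4},\ v_1v_{n-3},\ v_1v_{n-2},\ v_2v_{n-1}\}$. $\lfloor x\rfloor$ is the greatest integer not exceeding $x$; $\mathbb N=\{1,2,\ldots\}$. *)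

(* Defs.v *)
From HB Require Import structures.
From mathcomp Require Import all_boot all_order all_algebra.
Set Implicit Arguments. Unset Strict Implicit. Unset Printing Implicit Defensive.
Import Order.TTheory GRing.Theory Num.Theory.

Definition simple_graph (p : nat) (E : {set {set 'I_p}}) : bool :=
  [forall e in E, #|e| == 2].

Definition contains_copy (n p : nat) (L : {set {set 'I_n}}) (E : {set {set 'I_p}}) : bool :=
  [exists f : {ffun 'I_n -> 'I_p}, injectiveb f && [forall e in L, (f @: e) \in E]].

(* ex(p; L): maximum number of edges of an L-free simple graph on p vertices
   (the empty graph is always admissible when L has an edge, so the max is attained). *)
Definition ex (p n : nat) (L : {set {set 'I_n}}) : nat :=
  \max_(E : {set {set 'I_p}} | simple_graph E && ~~ contains_copy L E) #|E|.

Definition Tpp_edge (n i j : nat) : bool :=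
  [|| (i == 0) && (1 <= j <= n - 4),
      (i == 1) && ((j == n - 3) || (j == n - 2)) |
      (i == 2) && (j == n - 1)].

Definition Tpp (n : nat) : {set {set 'I_n}} :=
  [set e : {set 'I_n} | [exists i : 'I_n, exists j : 'I_n,
                           (e == [set i; j]) && Tpp_edge n i j]].

(* Main.v *)
Require Import Defs.
From HB Require Import structures.
From mathcomp Require Import all_boot all_order all_algebra.
From mathcomp Require Import zify.
Import Order.TTheory GRing.Theory Num.Theory.
Set Implicit Arguments. Unset Strict Implicit. Unset Printing Implicit Defensive.

(* Write M = n - 1. The value is the larger of the edge counts of k K_M + K_r
   and of (k-1) K_M + H, where H is an almost (n-5)-regular graph on M + r
   vertices; H is admissible because T_n'' has a vertex of degree n - 4.
   For the upper bound, argue by induction on the number m >= n of vertices. If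
   all degrees are at most n - 5, there are at most (n-5)m/2 edges. Otherwise
   take v0 of maximum degree d >= n - 4, with neighbourhood N. A path a - v1 - b
   and a disjoint edge v2 - c, with v1, v2 in N, extend to a copy of T_n'' as soon
   as N contains n - 6 further vertices. Forbidding this leaves so few edges that
   some set S of s <= M vertices meets at most C(s,2) of them (S is part of N, or
   N + v0 with at most two more vertices), and deleting S and its edges lowers the
   claimed bound by at least C(s,2). *)

(** * Edges meeting a set of vertices *)

Section Incidence.
Variables (V : finType) (g : rel V).
Hypotheses (gsym : symmetric g) (girr : irreflexive g).
Implicit Types (U S A B T : {set V}) (u v x : V).

Definition nbr U v := [set u in U | g v u].

Definition degsum U := \sum_(v in U) #|nbr U v|.

(* Twice the number of edges of [U] with at least one endpoint in [S]. *)
Definition inc U S := \sum_(v in S) (#|nbr U v| + #|nbr U v :\: S|).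

Lemma nbrI U S v : S \subset U -> nbr U v :&: S = nbr S v.
Proof.
move=> /subsetP sSU; apply/setP=> x; rewrite !inE.
by case xS: (x \in S); rewrite ?andbF // (sSU _ xS) /= andbT.
Qed.

Lemma nbrD U S v : nbr U v :\: S = nbr (U :\: S) v.
Proof. by apply/setP=> x; rewrite !inE andbA. Qed.

Lemma nbr_sub U v : nbr U v \subset U.
Proof. by apply/subsetP=> x; rewrite inE => /andP[]. Qed.

Lemma notin_nbr U v : v \notin nbr U v.
Proof. by rewrite inE girr andbF. Qed.

Lemma nbrC U u v : u \in U -> v \in nbr U u -> u \in nbr U v.
Proof. by move=> uU; rewrite !inE uU gsym => /andP[]. Qed.

Lemma card_nbr_split U S v :
  S \subset U -> #|nbr U v| = #|nbr S v| + #|nbr U v :\: S|.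
Proof. by move=> sSU; rewrite -(nbrI v sSU) cardsID. Qed.

Lemma card_nbr_lt S v : v \in S -> #|nbr S v| <= #|S|.-1.
Proof.
move=> vS; rewrite [#|S|](cardsD1 v) vS /=; apply/subset_leq_card/subsetD1P.
by rewrite nbr_sub notin_nbr.
Qed.

Lemma double_count A B :
  \sum_(v in A) #|nbr B v| = \sum_(v in B) #|nbr A v|.
Proof.
have cnt C v : #|nbr C v| = \sum_(u in C) g v u.
  rewrite -sum1_card (eq_bigl (fun u => (u \in C) && g v u)).
    by rewrite big_mkcondr /=; apply: eq_bigr => u _; case: (g v u).
  by move=> u; rewrite inE.
under eq_bigr do rewrite cnt.
rewrite exchange_big /=; apply: eq_bigr => u _; rewrite cnt.
by apply: eq_bigr => v _; rewrite gsym.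
Qed.

(** An edge from [S] to the rest of [U] adds 2 to the degree sum; [inc] counts both units at its end
    in [S], and double counting the cross edges balances the two sides. *)
Lemma degsumD U S : S \subset U -> degsum U = degsum (U :\: S) + inc U S.
Proof.
move=> sSU; rewrite /degsum /inc (big_setID S) /= (setIidPr sSU) big_split /=.
have -> : \sum_(v in S) #|nbr U v :\: S| = \sum_(v in U :\: S) #|nbr S v|.
  by under eq_bigr do rewrite nbrD; rewrite double_count.
have -> : \sum_(v in U :\: S) #|nbr U v|
    = \sum_(v in U :\: S) #|nbr S v| + \sum_(v in U :\: S) #|nbr (U :\: S) v|.
  by rewrite -big_split; apply: eq_bigr => v _; rewrite (card_nbr_split v sSU) nbrD.
by lia.
Qed.

Lemma degsum_le U : degsum U <= #|U| * #|U|.-1.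
Proof. by rewrite -sum_nat_const; apply: leq_sum => v; apply: card_nbr_lt. Qed.

Lemma inc1 U x : inc U [set x] = 2 * #|nbr U x|.
Proof.
rewrite /inc big_set1 mul2n -addnn; congr (_ + #|pred_of_set _|).
by apply/setDidPl; rewrite disjoint_sym disjoints1 notin_nbr.
Qed.

Lemma incU U A B : A \subset U -> B \subset U -> [disjoint A & B] ->
  inc U (A :|: B) = inc U A + inc (U :\: A) B.
Proof.
move=> sAU sBU dAB.
have sBUA : B \subset U :\: A by rewrite subsetD sBU disjoint_sym.
have sUU : A :|: B \subset U by rewrite subUset sAU.
move: (degsumD sAU) (degsumD sBUA) (degsumD sUU); rewrite setDDl; lia.
Qed.

Lemma incU1 U S x : S \subset U -> x \in U -> x \notin S ->
  inc U (x |: S) = inc U S + 2 * #|nbr U x :\: S|.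
Proof.
move=> sSU xU xS; rewrite setUC incU ?sub1set // ?inc1 ?nbrD //.
by rewrite disjoint_sym disjoints1.
Qed.

Lemma inc_le_deg U S d : (forall v, v \in S -> #|nbr U v| <= d) ->
  inc U S <= 2 * (#|S| * d).
Proof.
move=> dS; rewrite mulnCA -sum_nat_const; apply: leq_sum => v /dS vd.
rewrite mul2n -addnn leq_add // (leq_trans _ vd) // subset_leq_card //.
exact: subsetDl.
Qed.

Lemma inc_le_out U S m : S \subset U ->
  \sum_(v in S) #|nbr U v :\: S| <= m -> inc U S <= #|S| * #|S|.-1 + 2 * m.
Proof.
move=> sSU lem; rewrite /inc big_split /=.
have -> : \sum_(v in S) #|nbr U v| = degsum S + \sum_(v in S) #|nbr U v :\: S|.
  by rewrite -big_split; apply: eq_bigr => v _; rewrite (card_nbr_split v sSU).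
by have := degsum_le S; lia.
Qed.

(** An edge meeting the union lies inside [A] or meets [T]; the first kind is bounded by all pairs
    in [A], the second by the degrees in [T]. *)
Lemma inc_closed U A T : A \subset U -> T \subset U -> [disjoint A & T] ->
  (forall v, v \in A -> nbr U v \subset A :|: T) ->
  inc U (A :|: T) <= #|A| * #|A|.-1 + 2 * \sum_(v in T) #|nbr U v|.
Proof.
move=> sAU sTU dAT clA.
have sTUA : T \subset U :\: A by rewrite subsetD sTU disjoint_sym.
have disjE v : (v \in A) && (v \in T) = false.
  by apply/negbTE/negP => /andP[vA vT]; rewrite (disjointFr dAT vA) in vT.
rewrite incU // {1}/inc big_split /=.
have -> : \sum_(v in A) #|nbr U v :\: A| = \sum_(v in T) #|nbr A v|.
  rewrite double_count; apply: eq_bigr => v vA.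
  congr #|pred_of_set _|; apply/setP=> x; rewrite !inE.
  have := subsetP (clA v vA) x; rewrite !inE; have := disjE x.
  have := subsetP sTU x.
  by lia.
have -> : \sum_(v in A) #|nbr U v| = degsum A + \sum_(v in T) #|nbr A v|.
  rewrite (double_count T A) -big_split; apply: eq_bigr => v vA.
  rewrite (card_nbr_split v sAU); congr (_ + #|pred_of_set _|).
  apply/setP=> x; rewrite !inE.
  have := subsetP (clA v vA) x; rewrite !inE; have := disjE x.
  have := subsetP sTU x.
  by lia.
have : inc (U :\: A) T <= 2 * \sum_(v in T) #|nbr (U :\: A) v|.
  rewrite big_distrr /=; apply: leq_sum => v _.
  by rewrite mul2n -addnn leq_add2l subset_leq_card // subsetDl.
have : \sum_(v in T) #|nbr U v|
    = \sum_(v in T) #|nbr A v| + \sum_(v in T) #|nbr (U :\: A) v|.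
  by rewrite -big_split; apply: eq_bigr => v _; rewrite (card_nbr_split v sAU) nbrD.
by have := degsum_le A; lia.
Qed.

End Incidence.

(** * Embedding T_n'' *)

Lemma TppP n (e : {set 'I_n}) :
  reflect (exists i j : 'I_n, e = [set i; j] /\ Tpp_edge n i j) (e \in Tpp n).
Proof.
rewrite inE; apply: (iffP existsP) => [[i /existsP[j /andP[/eqP-> ij]]]|].
  by exists i, j.
by case=> i [j [-> ij]]; exists i; apply/existsP; exists j; rewrite eqxx.
Qed.

Lemma imset_set2 (aT rT : finType) (f : aT -> rT) x y :
  f @: [set x; y] = [set f x; f y].
Proof. by rewrite imsetU1 imset_set1. Qed.

Definition edge_rel p (E : {set {set 'I_p}}) : rel 'I_p :=
  fun u v => [set u; v] \in E.

Section Embedding.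
Variables (n p : nat) (E : {set {set 'I_p}}).
Hypothesis n_ge6 : 6 <= n.

(** The list enumerates the images of 0, ..., n - 1 in order: [t] supplies the leaves 3, ..., n - 4
    at [v0], and [a], [b], [c] are the images of n - 3, n - 2, n - 1. *)
Lemma Tpp_copy (v0 v1 v2 a b c : 'I_p) (t : seq 'I_p) :
  size t = n - 6 -> uniq ([:: v0; v1; v2] ++ t ++ [:: a; b; c]) ->
  all (edge_rel E v0) [:: v1, v2 & t] ->
  edge_rel E v1 a -> edge_rel E v1 b -> edge_rel E v2 c ->
  contains_copy (Tpp n) E.
Proof.
rewrite /edge_rel => st us /and3P[e1 e2 /allP et] ea eb ec.
set s := _ ++ _ in us.
have ss : size s = n by rewrite /s !size_cat st /=; lia.
apply/existsP; exists [ffun i : 'I_n => nth v0 s i]; apply/andP; split.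
  apply/injectiveP => i j; rewrite !ffunE => /eqP.
  by rewrite nth_uniq ?ss // => /eqP/val_inj.
apply/forall_inP => e /TppP[i [j [-> ij]]]; rewrite imset_set2 !ffunE.
have nthL (k : nat) x y : k < n - 6 -> nth v0 (x :: y :: t ++ [:: a; b; c]) k.+2 \in t.
  by move=> kt; rewrite /= nth_cat st kt mem_nth // st.
have nthR (k : nat) : nth v0 s (n - 3 + k) = nth v0 [:: a; b; c] k.
  rewrite /s catA nth_cat size_cat /= st; case: ifP => [|_]; first by lia.
  by congr nth; lia.
case/or3P: ij => [/andP[/eqP-> /andP[j0 jn]]|/andP[/eqP-> jn]|/andP[/eqP-> /eqP jn]].
- case: (nat_of_ord j) j0 jn => [|[|[|k]]] //= _ jn.
  by rewrite nth_cat st ifT ?et ?mem_nth ?st //; lia.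
- case/orP: jn => /eqP->; first by rewrite -[n - 3]addn0 nthR.
  by rewrite (_ : n - 2 = n - 3 + 1) ?nthR //; lia.
- by rewrite jn (_ : n - 1 = n - 3 + 2) ?nthR //; lia.
Qed.

(** Otherwise n - 6 vertices remain in [N v0] after removing [v1], [v2], [a], [b], [c], enough for
    the other leaves at [v0]. Among [a], [b], [c] only those in [N v0] cost anything, hence the
    correction terms. *)
Lemma Tpp_free_degree (U : {set 'I_p}) (v0 v1 v2 a b c : 'I_p) :
  let N := nbr (edge_rel E) U in
  irreflexive (edge_rel E) -> ~~ contains_copy (Tpp n) E ->
  uniq [:: v0; v1; v2; a; b; c] ->
  v1 \in N v0 -> v2 \in N v0 -> a \in N v1 -> b \in N v1 -> c \in N v2 ->
  #|N v0| < n - 4 + (a \in N v0) + (b \in N v0) + (c \in N v0).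
Proof.
move=> N irr /negP free us v1N v2N aN bN cN; rewrite ltnNge; apply/negP => dv.
apply: free.
pose R := N v0 :\ v1 :\ v2 :\ a :\ b :\ c.
have cR : n - 6 <= #|R|.
  have D1 (A : {set 'I_p}) x : A \subset N v0 -> #|A| <= #|A :\ x| + (x \in N v0).
    move=> /subsetP sA; rewrite (cardsD1 x) addnC leq_add2l.
    by case xA: (x \in A); rewrite ?(sA x xA).
  have sD (A : {set 'I_p}) x : A \subset N v0 -> A :\ x \subset N v0.
    exact/subset_trans/subsetDl.
  have s0 := subxx (mem (N v0)); have s1 := sD _ v1 s0; have s2 := sD _ v2 s1.
  have s3 := sD _ a s2; have s4 := sD _ b s3.
  move: (D1 _ v1 s0) (D1 _ v2 s1) (D1 _ a s2) (D1 _ b s3) (D1 _ c s4) dv.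
  rewrite -/R v1N v2N; clear.
  move: #|R| (nat_of_bool (a \in _)) (nat_of_bool (b \in _)) (nat_of_bool (c \in _)).
  move: #|N v0| #|N v0 :\ v1| #|N v0 :\ v1 :\ v2| #|N v0 :\ v1 :\ v2 :\ a|.
  by move: #|_ :\ b| => /=; lia.
have sR : size (take (n - 6) (enum R)) = n - 6.
  by rewrite size_takel // -cardE.
have uR : uniq (take (n - 6) (enum R)) by rewrite take_uniq // enum_uniq.
have RP x : x \in take (n - 6) (enum R) ->
  [&& edge_rel E v0 x, x != v0, x != v1, x != v2, x != a, x != b & x != c].
  move/mem_take; rewrite mem_enum !inE => /and5P[-> -> -> -> /and3P[-> _ e0]].
  by rewrite e0 !andbT /=; apply/eqP => x0; rewrite x0 irr in e0.
apply: (Tpp_copy (v0 := v0) (v1 := v1) (v2 := v2) (a := a) (b := b) (c := c) sR).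
- have RN x : x \in [:: v0; v1; v2; a; b; c] -> x \notin take (n - 6) (enum R).
    move=> xs; apply/negP => /RP; move: xs; rewrite !inE.
    by case/or4P=> [||| /or3P[]] /eqP->; rewrite eqxx ?andbF.
  rewrite (perm_uniq (_ : perm_eq _ (take (n - 6) (enum R) ++ [:: v0; v1; v2; a; b; c]))).
    by rewrite cat_uniq uR us andbT; apply/hasPn => x xs; apply: RN.
  by rewrite perm_catCA.
- move: v1N v2N; rewrite !inE /= => /andP[_ ->] /andP[_ ->] /=.
  by apply/allP => x /RP /andP[].
- by move: aN; rewrite inE => /andP[].
- by move: bN; rewrite inE => /andP[].
- by move: cN; rewrite inE => /andP[].
Qed.

End Embedding.

(** * Sets of vertices meeting few edges *)

Lemma card_leqD (T : finType) (A B : {set T}) : #|A| <= #|A :\: B| + #|B|.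
Proof. by rewrite -(cardsID B A) addnC leq_add2l subset_leq_card // subsetIr. Qed.

Lemma exists_subset_card (T : finType) (A : {set T}) k :
  k <= #|A| -> exists2 S : {set T}, S \subset A & #|S| = k.
Proof.
move=> kA; exists [set x in take k (enum A)].
  by apply/subsetP=> x; rewrite inE => /mem_take; rewrite mem_enum.
rewrite cardsE (card_uniqP _) ?take_uniq ?enum_uniq //.
by rewrite size_takel // -cardE.
Qed.

(** Serves to split t vertices of degree at most 3 off a set of n - 2 vertices. With n = q + t + 3
    the pair count drops by t(2q + t + 1), and q + t >= 7 makes this at least 6t. *)
Lemma pred_square_split_le n t k : 10 <= n -> t <= n - 3 -> k <= t * 3 ->
  (n - 2 - t) * (n - 2 - t).-1 + 2 * k <= (n - 2) * (n - 2).-1.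
Proof.
move=> n10 tn kt; have [q nE] : exists q, n = q + t + 3 by exists (n - 3 - t); lia.
have -> : n - 2 = (q + t).+1 by lia.
have -> : (q + t).+1 - t = q.+1 by lia.
have : t * 7 <= t * (q + t) by rewrite leq_mul2l; apply/orP; right; lia.
by move: kt; rewrite /=; clear; nia.
Qed.

(* [U] has a part of [s < n] vertices meeting at most [s (s - 1) / 2] edges of [U]. *)
Definition light (V : finType) (g : rel V) n (U : {set V}) :=
  [exists S : {set V},
    [&& S \subset U, 0 < #|S|, #|S| < n & inc g U S <= #|S| * #|S|.-1]].

Section LightPart.
Variables (V : finType) (g : rel V) (U : {set V}) (n : nat).
Hypotheses (gsym : symmetric g) (girr : irreflexive g) (n_ge10 : 10 <= n).
Local Notation N := (nbr g U).
Hypothesis free : forall v0 v1 v2 a b c : V, uniq [:: v0; v1; v2; a; b; c] ->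
  v1 \in N v0 -> v2 \in N v0 -> a \in N v1 -> b \in N v1 -> c \in N v2 ->
  #|N v0| < n - 4 + (a \in N v0) + (b \in N v0) + (c \in N v0).

Lemma lightI (S : {set V}) : S \subset U -> 0 < #|S| -> #|S| < n ->
  inc g U S <= #|S| * #|S|.-1 -> light g n U.
Proof. by move=> *; apply/existsP; exists S; apply/and4P. Qed.

Lemma nbr_neq u v : v \in N u -> v != u.
Proof. by apply: contraTneq => ->; apply: notin_nbr. Qed.

Lemma free_degree v0 v1 v2 a b c :
  v1 \in N v0 -> v2 \in N v0 -> v1 != v2 -> c \in N v2 :\: [set v0; v1] ->
  a \in N v1 :\: [set v0; v2; c] -> b \in N v1 :\: [set v0; v2; c] -> a != b ->
  #|N v0| < n - 4 + (a \in N v0) + (b \in N v0) + (c \in N v0).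
Proof.
rewrite !in_setD !in_set2 !in_setU !in_set1 !negb_or => v1N v2N v12.
move=> /andP[/andP[c0 c1] cN] /andP[/andP[/andP[a0 a2] ac] aN].
move=> /andP[/andP[/andP[b0 b2] bc] bN] ab.
have v10 := nbr_neq v1N; have v20 := nbr_neq v2N; have a1 := nbr_neq aN.
have b1 := nbr_neq bN; have c2 := nbr_neq cN.
apply: (free (v1 := v1) (v2 := v2)) => //; rewrite /= !inE !negb_or.
by repeat (apply/andP; split); rewrite // eq_sym.
Qed.

(** If some neighbour [w] has four neighbours besides [v0], all other vertices of [N v0] have degree
    at most 2, and n - 2 of them form a light part. If not, all degrees in [N v0] are at most 4, and
    any n - 1 of its vertices do, because 8 <= n - 2. *)
Lemma light_of_deg_ge v0 : n - 1 <= #|N v0| -> light g n U.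
Proof.
move=> dv; have NU := nbr_sub g U v0.
have [w /andP[wN w4]|no] := pickP (fun w => (w \in N v0) && (4 <= #|N w :\ v0|)).
  have deg2 v : v \in N v0 :\ w -> #|N v| <= 2.
    rewrite in_setD1 => /andP[vw vN].
    apply: leq_trans (_ : #|[set v0; w]| <= _); last by rewrite cards2; case: eqP.
    apply/subset_leq_card/subsetP => c cN; apply: contraTT dv => cn.
    (* Discarding [v] and [c] from the four neighbours of [w] leaves two for the path; even with
       [a], [b], [c] all in [N v0] this bounds the degree by n - 2. *)
    have : 1 < #|N w :\: [set v0; v; c]|.
      rewrite -setUA -setDDl; have := card_leqD (N w :\ v0) [set v; c].
      have := cards2 v c; case: eqP => _; lia.
    case/card_gt1P => a [b [aN bN ab]]; rewrite -ltnNge.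
    have cN' : c \in N v :\: [set v0; w] by rewrite in_setD cn.
    have := free_degree wN vN _ cN' aN bN ab; rewrite eq_sym => /(_ vw).
    move/leq_trans; apply; do 3!case: (_ \in N v0); clear -n_ge10; lia.
  have [|S sS cS] := @exists_subset_card _ (N v0 :\ w) (n - 2).
    by have := cardsD1 w (N v0); rewrite wN; lia.
  apply: (@lightI S); rewrite ?cS; try lia.
    exact: subset_trans sS (subset_trans (subsetDl _ _) NU).
  apply: leq_trans (inc_le_deg (d := 2) _) _.
    by move=> v /(subsetP sS); apply: deg2.
  by rewrite cS mulnCA leq_mul //; lia.
have [|S sS cS] := @exists_subset_card _ (N v0) (n - 1); first by lia.
apply: (@lightI S); rewrite ?cS; try lia.
  exact: subset_trans sS NU.
apply: leq_trans (inc_le_deg (d := 4) _) _.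
  move=> v /(subsetP sS) vN; have := no v; rewrite vN /= => /negbT.
  by rewrite -ltnNge (cardsD1 v0 (N v)) => lt4; case: (v0 \in N v); rewrite // ltnW.
by rewrite cS mulnCA leq_mul //; lia.
Qed.

Local Notation Ncl v := (v |: N v).

Lemma card_Ncl v : #|Ncl v| = #|N v|.+1.
Proof. by rewrite cardsU1 notin_nbr. Qed.

Lemma Ncl_sub v : v \in U -> Ncl v \subset U.
Proof. by move=> vU; rewrite subUset sub1set vU nbr_sub. Qed.

Lemma out_Ncl0 v : #|N v :\: Ncl v| = 0.
Proof. by apply/eqP; rewrite cards_eq0 setD_eq0 subsetUr. Qed.

Lemma sum_out_Ncl v k : (forall w, w \in N v -> #|N w :\: Ncl v| <= k) ->
  \sum_(w in Ncl v) #|N w :\: Ncl v| <= #|N v| * k.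
Proof.
move=> outk; rewrite big_setU1 ?notin_nbr //= out_Ncl0 add0n.
by rewrite -sum_nat_const; apply: leq_sum.
Qed.

(** If no edge left the closed neighbourhood of [v], that set would itself be light. *)
Lemma not_light_out v : v \in U -> #|N v|.+1 < n -> ~~ light g n U ->
  exists x y, x \in N v /\ y \in N x :\: Ncl v.
Proof.
move=> vU dv nl.
have [x /andP[xN /set0Pn[y yx]]|no] :=
    pickP (fun x => (x \in N v) && (N x :\: Ncl v != set0)); first by exists x, y.
case/negP: nl; apply: (@lightI (Ncl v)); rewrite ?card_Ncl ?Ncl_sub //.
rewrite -[X in _ <= X]addn0 -(muln0 2) -card_Ncl.
apply: inc_le_out => //; first exact: Ncl_sub.
apply: leq_trans (sum_out_Ncl (k := 0) _) _; last by rewrite muln0.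
by move=> w wN; have := no w; rewrite wN /= => /negbFE/eqP->; rewrite cards0.
Qed.

(** * Case analysis on the maximum degree *)

Section MaxDegree.
Variable v0 : V.
Hypotheses (v0U : v0 \in U) (v0max : forall v, v \in U -> #|N v| <= #|N v0|).

Lemma max_nbr u w : w \in N u -> #|N w| <= #|N v0|.
Proof. by move=> wN; apply: v0max; apply: (subsetP (nbr_sub g U u)). Qed.

(** An edge from [x] in [N v0] to [y] outside the closed neighbourhood serves as the branch of
    length 2. Every other [w] in [N v0] then has at most one neighbour besides [v0], [x], [y], so
    its degree is at most 4. *)
Lemma light_of_deg_n2 : #|N v0| = n - 2 -> light g n U.
Proof.
move=> dv; apply: contraT => nl.
have [|x [y [xN yx]]] := not_light_out v0U _ nl; first by lia.
have deg4 w : w \in N v0 :\ x -> #|N w| <= 4.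
  rewrite in_setD1 => /andP[wx wN].
  have out1 : #|N w :\: [set v0; x; y]| <= 1.
    rewrite leqNgt; apply/negP => /card_gt1P[a [b [aN bN ab]]].
    move: yx; rewrite in_setD in_setU1 negb_or => /andP[/andP[yv yN] yx].
    have yw : y \in N x :\: [set v0; w].
      rewrite in_setD in_set2 negb_or yv yx andbT.
      by apply: contraNneq yN => ->.
    have := free_degree wN xN wx yw aN bN ab; rewrite dv (negbTE yN).
    by do 2!case: (_ \in N v0); clear -n_ge10; lia.
  have := card_leqD (N w) [set v0; x; y]; move: out1.
  have : #|[set v0; x; y]| <= 3.
    by rewrite setUC cardsU1 cards2; case: (y \notin _); case: (v0 == x).
  by move: #|_ :\: _| #|[set _; _; _]| => ? ?; lia.
case/negP: nl; apply: (@lightI (Ncl v0)); rewrite ?card_Ncl ?Ncl_sub ?dv //; try lia.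
(* All edges at [v0] already meet [N v0], so [v0] enlarges the set for free. *)
rewrite incU1 ?nbr_sub ?notin_nbr // setDv cards0.
have sx : N v0 :\ x \subset U by exact: subset_trans (subsetDl _ _) (nbr_sub g U v0).
rewrite -[X in inc _ _ X](setD1K xN) incU1 //; last first.
- by rewrite !inE eqxx.
- exact: subsetP (nbr_sub g U v0) _ xN.
have := inc_le_deg (g := g) (U := U) deg4.
have : #|N x :\: (N v0 :\ x)| <= n - 2.
  by rewrite -dv (leq_trans (subset_leq_card (subsetDl _ _))) // (max_nbr xN).
have -> : #|N v0 :\ x| = n - 3 by have := cardsD1 x (N v0); rewrite xN; lia.
(* The inequality is 8(n - 3) + 2(n - 2) <= (n - 1)(n - 2), that is, (n - 3)(n - 10) >= 0. *)
move: #|_ :\: _| (inc _ _ _) => k i; rewrite (_ : n = n - 10 + 10); last by lia.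
by move: (n - 10) => m; nia.
Qed.

(** Call a neighbour outer if it lies outside the closed neighbourhood of [v0]. Three cases: some
    [w] in [N v0] has two outer neighbours; each has at most one and all of these are the same [y];
    each has at most one and two different ones occur. *)
Lemma light_of_deg_n3 : #|N v0| = n - 3 -> light g n U.
Proof.
move=> dv; apply: contraT => nl.
have NU := nbr_sub g U v0; have SU := Ncl_sub v0U.
have cS : #|Ncl v0| = n - 2 by rewrite card_Ncl dv; lia.
have notS y : y \notin Ncl v0 -> y != v0 /\ forall w, w \in N v0 -> y != w.
  rewrite in_setU1 negb_or => /andP[y0 yN]; split=> // w wN.
  by apply: contraNneq yN => ->.
have [w /andP[wN /card_gt1P[a [b [aw bw ab]]]]|no] :=
    pickP (fun w => (w \in N v0) && (1 < #|N w :\: Ncl v0|)).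
  move: aw bw; rewrite !in_setD => /andP[aS aN] /andP[bS bN].
  have [a0 aNn] := notS _ aS; have [b0 bNn] := notS _ bS.
  (* As [a] and [b] are not in [N v0], a third possible [c] would force the degree of [v0] below n -
     3. *)
  have sub4 v : v \in N v0 :\ w -> N v :\: [set v0; w] \subset [set a; b].
    rewrite in_setD1 => /andP[vw vN]; apply/subsetP => c cv; apply: contraT.
    rewrite in_set2 negb_or => /andP[ca cb].
    have aN' : a \in N w :\: [set v0; v; c].
      by rewrite in_setD in_setU in_set2 in_set1 !negb_or a0 aNn //= (eq_sym a) ca.
    have bN' : b \in N w :\: [set v0; v; c].
      by rewrite in_setD in_setU in_set2 in_set1 !negb_or b0 bNn //= (eq_sym b) cb.
    have := free_degree wN vN _ cv aN' bN' ab; rewrite eq_sym => /(_ vw).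
    move: aS bS; rewrite dv !in_setU1 !negb_or => /andP[_ /negbTE->] /andP[_ /negbTE->].
    by case: (_ \in N v0); clear -n_ge10; lia.
  case/negP: nl; apply: (@lightI (Ncl v0)); rewrite ?cS //; try by clear -n_ge10; lia.
  (* Deleting [v0], then [w], then the other neighbours removes at most n - 3, n - 4 and 2(n - 4)
     edges. *)
  have E : Ncl v0 = (w |: [set v0]) :|: (N v0 :\ w).
    by apply/setP=> x; rewrite !in_setU !in_set1 in_setD1; case: (eqVneq x w) => [->|_];
      rewrite ?wN ?orbT //= orbF.
  have v0w : v0 != w by rewrite eq_sym (nbr_neq wN).
  have wU := subsetP NU _ wN.
  have sA : w |: [set v0] \subset U by rewrite subUset !sub1set wU v0U.
  have dw : #|N w :\: [set v0]| <= n - 4.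
    have := cardsD1 v0 (N w); rewrite (nbrC gsym v0U wN).
    by have := max_nbr wN; rewrite dv; clear; lia.
  have cB : #|N v0 :\ w| = n - 4.
    by have := cardsD1 w (N v0); rewrite wN dv; clear -n_ge10; lia.
  have B2 : inc g (U :\: (w |: [set v0])) (N v0 :\ w) <= 2 * ((n - 4) * 2).
    rewrite -cB; apply: inc_le_deg => v vB; rewrite -nbrD setUC.
    apply: leq_trans (subset_leq_card (sub4 v vB)) _.
    by rewrite cards2; case: (a != b).
  rewrite E incU //; first last.
  - rewrite -setI_eq0; apply/eqP/setP=> x; rewrite !inE.
    by case: (x == w) => //=; case: eqVneq => //= ->; rewrite girr andbF.
  - exact: subset_trans (subsetDl _ _) NU.
  rewrite incU1 ?sub1set // ?in_set1 1?eq_sym // inc1 // dv.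
  move: dw B2; move: #|_ :\: _| (inc _ _ _) => k i.
  rewrite -(subnK n_ge10); move: (n - 10); clear => m; nia.
have out1 w : w \in N v0 -> #|N w :\: Ncl v0| <= 1.
  by move=> wN; rewrite leqNgt; have := no w; rewrite wN /= => ->.
have [|x [y [xN yx]]] := not_light_out v0U _ nl; first by rewrite dv; clear -n_ge10; lia.
have [x' /andP[x'N /set0Pn[y']]|one] :=
    pickP (fun x' => (x' \in N v0) && ((N x' :\: Ncl v0) :\ y != set0)); last first.
  (* Here all outer edges end in [y], so adding [y] closes the neighbourhood at a cost of at most n
     - 3 edges. *)
  have yU : y \in U by move: yx; rewrite in_setD => /andP[_]; apply/subsetP/nbr_sub.
  have yS : y \notin Ncl v0 by move: yx; rewrite in_setD => /andP[].
  have dS : [disjoint Ncl v0 & [set y]] by rewrite disjoint_sym disjoints1.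
  have cSy : #|Ncl v0 :|: [set y]| = n - 1.
    by rewrite (setUC (Ncl v0)) cardsU1 yS cS; clear -n_ge10; lia.
  case/negP: nl; apply: (@lightI (Ncl v0 :|: [set y])).
  - by rewrite subUset SU sub1set.
  - by rewrite cSy; clear -n_ge10; lia.
  - by rewrite cSy; clear -n_ge10; lia.
  apply: leq_trans (inc_closed _ _ SU _ dS _) _ => //; first by rewrite sub1set.
    move=> v; rewrite in_setU1 => /orP[/eqP->|vN].
      exact: subset_trans (subsetUr _ _) (subsetUl _ _).
    by have := one v; rewrite vN -subDset => /= /negbFE; rewrite setD_eq0.
  have := v0max yU; rewrite big_set1 cSy cS dv; move: #|_| => k.
  by rewrite -(subnK n_ge10); move: (n - 10); clear => m; nia.
rewrite in_setD1 => /andP[y'y yx'].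
pose T := [set w in N v0 | N w :\: Ncl v0 != set0].
have TN : T \subset N v0 by apply/subsetP=> w; rewrite inE => /andP[].
have deg3 w : w \in T -> #|N w| <= 3.
  rewrite inE => /andP[wN /set0Pn[z zw]].
  (* Since [y] and [y'] differ, one of them is not [z]; its inner end is not [w], whose only outer
     neighbour is [z]. *)
  have [x1 [y1 [x1N y1x y1z]]] : exists x1 y1,
      [/\ x1 \in N v0, y1 \in N x1 :\: Ncl v0 & y1 != z].
    by case: (eqVneq y z) => [<-|yz]; [exists x', y'|exists x, y].
  have wx1 : w != x1.
    apply: contraNneq y1z => wx1; rewrite -wx1 in y1x.
    by apply/eqP; apply: (card_le1_eqP (out1 w wN)).
  apply: leq_trans (_ : #|[set v0; x1; z]| <= _); last first.
    by rewrite setUC cardsU1 cards2; case: (z \notin _); case: (v0 == x1).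
  apply/subset_leq_card/subsetP => b bw; apply: contraT.
  rewrite in_setU in_set2 in_set1 !negb_or => /andP[/andP[b0 bx] bz].
  have bN : b \in N v0.
    have : b \in Ncl v0.
      apply: contraNT bz => bS; apply/eqP/(card_le1_eqP (out1 w wN)) => //.
      by rewrite in_setD bS.
    by rewrite in_setU1 (negbTE b0).
  move: y1x zw; rewrite !in_setD => /andP[/notS[y10 y1n] y1x] /andP[zS zw].
  have [z0 zn] := notS _ zS.
  have y1' : y1 \in N x1 :\: [set v0; w].
    by rewrite in_setD in_set2 negb_or y10 y1n.
  have z' : z \in N w :\: [set v0; x1; y1].
    by rewrite in_setD in_setU in_set2 in_set1 !negb_or z0 zn //= (eq_sym z) y1z.
  have b' : b \in N w :\: [set v0; x1; y1].
    by rewrite in_setD in_setU in_set2 in_set1 !negb_or b0 bx (eq_sym b) y1n.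
  have := free_degree wN x1N wx1 y1' z' b' _; rewrite eq_sym => /(_ bz).
  have -> : (z \in N v0) = false by apply/negP => /zn; rewrite eqxx.
  have -> : (y1 \in N v0) = false by apply/negP => /y1n; rewrite eqxx.
  by rewrite bN dv; clear -n_ge10; lia.
have TS : T \subset Ncl v0 := subset_trans TN (subsetUr _ _).
have ST : Ncl v0 :\: T :|: T = Ncl v0 by rewrite setUC -[X in X :|: _](setIidPr TS) setID.
have dT : [disjoint Ncl v0 :\: T & T].
  rewrite -setI_eq0; apply/eqP/setP=> u; rewrite in_setI in_setD in_set0.
  by case: (u \in T); rewrite ?andbF.
have cT : #|Ncl v0 :\: T| = n - 2 - #|T| by rewrite cardsD (setIidPr TS) cS.
case/negP: nl; apply: (@lightI (Ncl v0)); rewrite ?cS //; try by clear -n_ge10; lia.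
rewrite -{1}ST; apply: leq_trans (inc_closed _ _ _ _ dT _) _ => //.
- exact: subset_trans (subsetDl _ _) SU.
- exact: subset_trans TS SU.
- move=> u; rewrite ST in_setD in_setU1 => /andP[uT /orP[/eqP->|uN]].
    exact: subsetUr.
  by rewrite -setD_eq0; move: uT; rewrite inE uN negbK.
have sT : \sum_(w in T) #|N w| <= #|T| * 3 by rewrite -sum_nat_const; apply: leq_sum.
have := subset_leq_card TN; rewrite cT dv.
by move=> tn; apply: pred_square_split_le tn sT.
Qed.

(** Let [w] have outer neighbours [a] and [b]. Any other vertex of [N v] has its outer neighbours
    among them. If [w] has a third one, only [w] has outer neighbours and the closed neighbourhood
    is light; if not, it becomes light once [a] and [b] are added. *)
Lemma light_out_n4 v : v \in U -> #|N v| = n - 4 ->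
  (forall u, u \in U -> #|N u| <= n - 4) -> ~~ light g n U ->
  forall w, w \in N v -> #|N w :\: Ncl v| <= 1.
Proof.
move=> vU dv dmax nl w wN; rewrite leqNgt; apply: contra nl.
case/card_gt1P => a [b [aw bw ab]].
have NU := nbr_sub g U v; have SU := Ncl_sub vU; have wU := subsetP NU _ wN.
have cS : #|Ncl v| = n - 3 by rewrite card_Ncl dv; clear -n_ge10; lia.
have notS y : y \in U :\: Ncl v -> y != v /\ forall w, w \in N v -> y != w.
  rewrite in_setD in_setU1 negb_or => /andP[/andP[y0 yN] _]; split=> // w' w'N.
  by apply: contraNneq yN => ->.
have outU u : N u :\: Ncl v \subset U :\: Ncl v by apply/setSD/nbr_sub.
have only2 w' a' b' c : w' \in N v :\ w -> c \in N w' :\: Ncl v ->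
    a' \in N w :\: Ncl v -> b' \in N w :\: Ncl v -> a' != b' -> c \in [set a'; b'].
  rewrite in_setD1 => /andP[w'w w'N] cw aw' bw' ab'; apply: contraT.
  rewrite in_set2 negb_or => /andP[ca cb].
  have [c0 cn] := notS _ (subsetP (outU _) _ cw).
  have [a0 an] := notS _ (subsetP (outU _) _ aw').
  have [b0 bn] := notS _ (subsetP (outU _) _ bw').
  move: aw' bw' cw; rewrite !in_setD => /andP[_ aw'] /andP[_ bw'] /andP[_ cw].
  have c' : c \in N w' :\: [set v; w] by rewrite in_setD in_set2 negb_or c0 cn.
  have aw2 : a' \in N w :\: [set v; w'; c].
    by rewrite in_setD in_setU in_set2 in_set1 !negb_or a0 an //= (eq_sym a') ca.
  have bw2 : b' \in N w :\: [set v; w'; c].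
    by rewrite in_setD in_setU in_set2 in_set1 !negb_or b0 bn //= (eq_sym b') cb.
  have := free_degree wN w'N _ c' aw2 bw2 ab'; rewrite eq_sym => /(_ w'w).
  have -> : (a' \in N v) = false by apply/negP => /an; rewrite eqxx.
  have -> : (b' \in N v) = false by apply/negP => /bn; rewrite eqxx.
  have -> : (c \in N v) = false by apply/negP => /cn; rewrite eqxx.
  by rewrite dv !addn0 ltnn.
have [e /andP[ew eab]|noe] := pickP (fun e => (e \in N w :\: Ncl v) && (e \notin [set a; b])).
  (* The pairs {a, b}, {a, e} and {b, e} have no common element. *)
  have out0 w' : w' \in N v :\ w -> N w' :\: Ncl v = set0.
    move=> w'N; apply/eqP; rewrite -subset0; apply/subsetP=> c cw.
    move: eab; rewrite !inE negb_or => /andP[ea eb].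
    have := only2 _ _ _ _ w'N cw aw bw ab; have := only2 _ _ _ _ w'N cw aw ew _.
    rewrite (eq_sym a) => /(_ ea); have := only2 _ _ _ _ w'N cw bw ew _.
    rewrite (eq_sym b) => /(_ eb); rewrite !in_set2.
    case/orP=> /eqP->; first by rewrite (eq_sym b) (negbTE ab) (eq_sym b) (negbTE eb).
    by rewrite (negbTE ea) (negbTE eb).
  have wS : w \in Ncl v by rewrite in_setU1 wN orbT.
  have E : (Ncl v :\ w) :|: [set w] = Ncl v by rewrite setUC setD1K.
  have cA : #|Ncl v :\ w| = n - 4.
    by have := cardsD1 w (Ncl v); rewrite wS cS; clear -n_ge10; lia.
  apply: (@lightI (Ncl v)); rewrite ?cS //; try by clear -n_ge10; lia.
  have dA : [disjoint Ncl v :\ w & [set w]].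
    by rewrite disjoint_sym disjoints1 !inE eqxx.
  rewrite -{1}E; apply: leq_trans (inc_closed _ _ _ _ dA _) _ => //.
  - exact: subset_trans (subsetDl _ _) SU.
  - by rewrite sub1set.
  - move=> u; rewrite E in_setD1 in_setU1 => /andP[uw /orP[/eqP->|uN]].
      exact: subsetUr.
    by rewrite -setD_eq0 out0 // in_setD1 uw.
  (* Equality is possible: (n - 4)(n - 5) + 2(n - 4) = (n - 3)(n - 4). *)
  rewrite big_set1 cA; have := dmax w wU; move: #|_| => k.
  by rewrite -(subnK n_ge10); move: (n - 10); clear => m; nia.
have aU := subsetP (outU _) _ aw; have bU := subsetP (outU _) _ bw.
move: (aU) (bU); rewrite !in_setD => /andP[aS aU'] /andP[bS bU'].
have dA : [disjoint Ncl v & [set a; b]].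
  rewrite disjoint_sym -setI_eq0; apply/eqP/setP=> x; rewrite in_setI in_set2 in_set0.
  by apply/andP=> -[/orP[/eqP->|/eqP->]]; apply/negP.
have cAab : #|Ncl v :|: [set a; b]| = n - 1.
  rewrite cardsU (disjoint_setI0 dA) cards0 cS cards2 ab.
  by clear -n_ge10; lia.
apply: (@lightI (Ncl v :|: [set a; b])); rewrite ?cAab; try by clear -n_ge10; lia.
  by rewrite subUset SU subUset !sub1set aU'.
apply: leq_trans (inc_closed _ _ SU _ dA _) _ => //.
  by rewrite subUset !sub1set aU'.
  move=> u; rewrite in_setU1 => /orP[/eqP->|uN].
    exact: subset_trans (subsetUr _ _) (subsetUl _ _).
  rewrite -subDset; apply/subsetP=> c cu; case: (eqVneq u w) => [uw|uw].
    by have := noe c; rewrite -uw cu => /negbFE.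
  by apply: only2 cu aw bw ab; rewrite in_setD1 uw.
rewrite cS big_setU1 ?in_set1 //= big_set1.
have := dmax a aU'; have := dmax b bU'; move: #|_| #|_| => k l.
by rewrite -(subnK n_ge10); move: (n - 10); clear => m; nia.
Qed.

(* Either all vertices of [N v0] with a neighbour outside have degree at most
   [n - 5], and counting degrees suffices, or one of them, [w], has degree [n - 4];
   then the previous lemma, applied at [w], controls its outside neighbour [b]. *)
Lemma light_of_deg_n4 : #|N v0| = n - 4 -> light g n U.
Proof.
move=> dv; apply: contraT => nl.
have dmax u : u \in U -> #|N u| <= n - 4 by rewrite -dv; apply: v0max.
have NU := nbr_sub g U v0; have SU := Ncl_sub v0U.
have cS : #|Ncl v0| = n - 3 by rewrite card_Ncl dv; clear -n_ge10; lia.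
have out1 := light_out_n4 v0U dv dmax nl.
have [w /andP[/andP[wN /set0Pn[b bw]] /eqP dw]|now] := pickP (fun w =>
    (w \in N v0) && (N w :\: Ncl v0 != set0) && (#|N w| == n - 4)); last first.
  (* A vertex with an outer neighbour has just one and degree at most n - 5, so every summand of
     [inc] is at most n - 4. *)
  case/negP: nl; apply: (@lightI (Ncl v0)); rewrite ?cS //; try by clear -n_ge10; lia.
  rewrite (_ : (n - 3).-1 = n - 4); last by clear -n_ge10; lia.
  rewrite -cS -sum_nat_const; apply: leq_sum => w.
  rewrite in_setU1 => /orP[/eqP->|wN]; first by rewrite out_Ncl0 dv addn0.
  have wU := subsetP NU _ wN.
  have := now w; rewrite wN /=; case: eqVneq => /= [->|o0 dw]; first by rewrite cards0 addn0 dmax.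
  have := dmax w wU; rewrite leq_eqVlt dw /= => lt; apply: leq_trans lt.
  by rewrite -addn1 leq_add2l out1.
have wU := subsetP NU _ wN.
have bNw : b \in N w by move: bw; rewrite in_setD => /andP[].
have bU : b \in U by apply: subsetP (nbr_sub g U w) _ bNw.
have bS : b \notin Ncl v0 by move: bw; rewrite in_setD => /andP[].
have outb : #|N b :\: Ncl v0| <= 1.
  (* As [b] is the only outer neighbour of [w], a neighbour of [b] outside [Ncl v0] is also outside
     [Ncl w]. *)
  apply: leq_trans (light_out_n4 wU dw dmax nl bNw).
  apply/subset_leq_card/subsetP => u; rewrite in_setD => /andP[uS ub].
  rewrite in_setD ub andbT in_setU1 negb_or; apply/andP; split.
    by apply: contraNneq uS => ->; rewrite in_setU1 wN orbT.
  apply: contraTN ub => uw.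
  have -> : u = b by apply: (card_le1_eqP (out1 w wN)) => //; rewrite in_setD uS.
  exact: notin_nbr.
case/negP: nl; apply: (@lightI (b |: Ncl v0)).
- by rewrite subUset sub1set bU.
- by rewrite cardsU1 bS.
- by rewrite cardsU1 bS cS; clear -n_ge10; lia.
rewrite incU1 // cardsU1 bS cS.
(* Again without slack: (n - 3)(n - 4) + 2(n - 4) + 2 = (n - 2)(n - 3). *)
have := inc_le_out girr SU (sum_out_Ncl out1); rewrite cS dv.
move: outb; move: #|_| (inc _ _ _) => k i.
by rewrite -(subnK n_ge10); move: (n - 10); clear => m; nia.
Qed.

Lemma light_of_max_deg : n - 4 <= #|N v0| -> light g n U.
Proof.
move=> dv; have [|d1] := leqP (n - 1) #|N v0|; first exact: light_of_deg_ge.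
have [/eqP|[/eqP|/eqP]] : #|N v0| == n - 2 \/ #|N v0| == n - 3 \/ #|N v0| == n - 4.
  by move: dv d1; clear -n_ge10; lia.
- exact: light_of_deg_n2.
- exact: light_of_deg_n3.
- exact: light_of_deg_n4.
Qed.

End MaxDegree.
End LightPart.

(** * Arithmetic of the extremal value *)

Lemma bin2_sq m : 2 * 'C(m, 2) + m = m * m.
Proof. by elim: m => // m IH; rewrite binS bin1 mulnDr; clear -IH; nia. Qed.

Lemma bin2_mul m : m * m.-1 = 2 * 'C(m, 2).
Proof. by have := bin2_sq m; case: m => [|m] /=; [lia|rewrite mulnS; lia]. Qed.

(* The larger of the edge counts of [k K_(n-1) + K_r] and of [k - 1] copies of
   [K_(n-1)] plus an almost [(n-5)]-regular graph on [n - 1 + r] vertices. *)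
Definition turan_value n k r :=
  maxn (k * 'C(n - 1, 2) + 'C(r, 2))
       (if k is k'.+1 then k' * 'C(n - 1, 2) + ((n - 5) * (n - 1 + r))./2 else 0).

Lemma divn_carry M k r s k' r' : r < M -> s <= M -> r' < M ->
  k * M + r + s = k' * M + r' ->
  k' = k /\ r' = r + s \/ [/\ k' = k.+1, M <= r + s & r' = r + s - M].
Proof.
move=> rM sM r'M; have [rs|rs] := ltnP (r + s) M => E; [left|right].
  have kk' : k' = k.
    have := congr1 (fun x => x %/ M) E.
    by rewrite -addnA !divnMDl; try lia; rewrite !divn_small //; lia.
  by split=> //; rewrite kk' -addnA in E; exact/esym/(addnI E).
have {}E : k.+1 * M + (r + s - M) = k' * M + r'.
  by rewrite -E mulSn; move: (k * M); lia.
have kk' : k' = k.+1.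
  have := congr1 (fun x => x %/ M) E.
  by rewrite !divnMDl; try lia; rewrite !divn_small //; lia.
by split=> //; rewrite kk' in E; exact/esym/(addnI E).
Qed.

(** The induction step of the upper bound in numbers. Either r + s stays below n - 1 or a block of n
    - 1 vertices is completed; in both cases each term of the maximum is treated separately. *)
Lemma turan_value_add n k r s k' r' : 10 <= n -> s <= n - 1 -> r < n - 1 -> r' < n - 1 ->
  k * (n - 1) + r + s = k' * (n - 1) + r' ->
  turan_value n k r + 'C(s, 2) <= turan_value n k' r'.
Proof.
rewrite /turan_value => n10.
have [D [-> -> D5]] : exists D, [/\ n - 5 = D, n - 1 = D + 4 & 5 <= D].
  by exists (n - 5); split; lia.
move=> sM rM r'M /divn_carry [] // [-> r'E]; rewrite addn_maxl geq_max.
  have sq1 := bin2_sq r; have sq2 := bin2_sq s; have sq3 := bin2_sq (r + s).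
  have Crs : 'C(r, 2) + 'C(s, 2) <= 'C(r + s, 2) by clear -sq1 sq2 sq3; nia.
  rewrite r'E; apply/andP; split; first by rewrite leq_max -addnA leq_add2l Crs.
  case: k => [|k]; first by rewrite leq_max; apply/orP; left; lia.
  (* For s <= D + 1, the gain of about Ds/2 covers C(s,2). Otherwise r <= 1, and the almost regular
     graph has at most C(D + 4, 2) edges, so the first term dominates. *)
  have [sD|Ds] := leqP s (D + 1).
    rewrite leq_max; apply/orP; right; rewrite -addnA leq_add2l addnA (mulnDr D (D + 4 + r)).
    have : 2 * 'C(s, 2) <= D * s by move: sD sq2; clear; nia.
    by move: (D * _) (D * _) 'C(s, 2); clear=> x y z; lia.
  rewrite leq_max; apply/orP; left.
  have : (D * (D + 4 + r))./2 <= 'C(D + 4, 2).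
    have : D * (D + 4 + r) <= 2 * 'C(D + 4, 2).
      have r1 : r <= 1 by move: r'M Ds; rewrite r'E; clear; lia.
      apply: (@leq_trans (D * (D + 4 + 1))); first by rewrite leq_mul2l leq_add2l r1 orbT.
      by have := bin2_sq (D + 4); move: D5; clear; nia.
    by move: (D * _) 'C(_, 2); clear; lia.
  by rewrite mulSn; move: (k * _) (_./2) => x y; move: Crs; clear; lia.
move: r'E => rs ->.
have sq1 := bin2_sq r; have sq2 := bin2_sq s; have sq3 := bin2_sq (D + 4).
have [u sE] : exists u, D + 4 = s + u by exists (D + 4 - s); lia.
have [w rE] : exists w, r = u + w by exists (r - u); lia.
have -> : r + s - (D + 4) = w by lia.
have sq4 := bin2_sq w.
(* Convexity: the sums r + s and (D + 4) + w agree, and the difference of the two sides is u(s -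
   w). *)
have key : 'C(r, 2) + 'C(s, 2) <= 'C(D + 4, 2) + 'C(w, 2).
  have ws : u * w <= u * s by rewrite leq_mul2l; apply/orP; right; lia.
  move: sq1 sq2 sq3 sq4 ws; rewrite sE rE.
  move: 'C(_, 2) 'C(_, 2) 'C(_, 2) 'C(_, 2); clear; nia.
apply/andP; split; rewrite leq_max.
  apply/orP; left; rewrite mulSn; move: key; move: (k * _); clear; lia.
case: k => [|k]; apply/orP; [left|right].
  by rewrite mul1n add0n (leq_trans (leq_addl _ _) key).
rewrite mulSn.
suff : (D * (D + 4 + r))./2 + 'C(s, 2) <= 'C(D + 4, 2) + (D * (D + 4 + w))./2.
  by move: (k * _) (_./2) (_./2); clear; lia.
(* The doubled binomials differ by u(s + D + 3). *)
have : D * u + 2 * 'C(s, 2) <= 2 * 'C(D + 4, 2).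
  by rewrite sE in sq3 *; move: sq2 sq3 sE; move: 'C(_, 2) 'C(_, 2); clear; nia.
rewrite rE (addnC u) addnA (mulnDr D (D + 4 + w)).
by move: (D * _) (D * _) 'C(_, 2) 'C(_, 2); clear; lia.
Qed.

(** * Upper bound *)

Lemma edge_relC p (E : {set {set 'I_p}}) : symmetric (edge_rel E).
Proof. by move=> u v; rewrite /edge_rel setUC. Qed.

Lemma edge_rel_irr p (E : {set {set 'I_p}}) : simple_graph E -> irreflexive (edge_rel E).
Proof.
move=> /forall_inP sE u; apply/negP => /sE.
by rewrite setUid cards1.
Qed.

Definition degree p (E : {set {set 'I_p}}) v := #|[set e in E | v \in e]|.

Lemma degreeE p (E : {set {set 'I_p}}) v : degree E v = \sum_(e in E) (v \in e).
Proof.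
rewrite /degree -sum1_card (eq_bigl (fun e => (e \in E) && (v \in e))).
  by rewrite big_mkcondr; apply: eq_bigr => e _; case: (v \in e).
by move=> e; rewrite inE.
Qed.

Lemma sum_degree p (E : {set {set 'I_p}}) :
  simple_graph E -> \sum_v degree E v = 2 * #|E|.
Proof.
move=> /forall_inP sE.
rewrite (eq_bigr _ (fun v _ => degreeE E v)).
rewrite exchange_big /= mulnC -sum_nat_const; apply: eq_bigr => e eE.
rewrite -(eqP (sE e eE)) -sum1_card [RHS]big_mkcond /=.
by apply: eq_bigr => v _; case: (v \in e).
Qed.

Lemma nbr_degree p (E : {set {set 'I_p}}) v :
  simple_graph E -> #|nbr (edge_rel E) setT v| = degree E v.
Proof.
move=> sE; have irr := edge_rel_irr sE.
rewrite -(card_in_imset (f := fun u => [set v; u])).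
  congr #|pred_of_set _|; apply/setP=> e; apply/imsetP/idP => [[u]|].
    by rewrite !inE /= => vu ->; rewrite set21 andbT; apply: vu.
  rewrite inE => /andP[eE ve]; have := forall_inP sE e eE.
  case/cards2P => x [y [_ eE']]; move: ve; rewrite eE' in_set2.
  case/orP=> /eqP->; [exists y => //|exists x; rewrite 1?setUC //].
    by rewrite !inE /edge_rel -eE'.
  by rewrite !inE /edge_rel setUC -eE'.
move=> u w; rewrite !inE => vu vw /setP /(_ u).
rewrite !inE eqxx orbT; case/esym/orP => /eqP // uv.
by rewrite uv irr in vu.
Qed.

Section UpperBound.
Variables (n p : nat) (E : {set {set 'I_p}}).
Hypotheses (n_ge10 : 10 <= n) (sE : simple_graph E).
Hypothesis freeE : ~~ contains_copy (Tpp n) E.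
Local Notation g := (edge_rel E).
Let gsym : symmetric g := @edge_relC p E.
Let girr : irreflexive g := edge_rel_irr sE.

Lemma degsum_upper (U : {set 'I_p}) k r : #|U| = k * (n - 1) + r -> r < n - 1 ->
  (degsum g U)./2 <= turan_value n k r.
Proof.
have [m] := ubnP #|U|; elim: m U k r => // m IH U k r /ltnSE Um cU rn.
have degU : (degsum g U)./2 <= 'C(#|U|, 2).
  by rewrite bin2; apply/half_leq/degsum_le.
have [Usmall|Ubig] := leqP #|U| (n - 1).
  (* The complete graph gives the bound here: either k = 0, or k = 1 and r = 0. *)
  apply: leq_trans degU _; rewrite /turan_value cU.
  case: k cU => [|k] cU; first by rewrite leq_max leqnn.
  have [-> ->] : k = 0 /\ r = 0.
    by move: Usmall; rewrite cU mulSn; move: (n - 1) rn => M rM; nia.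
  by rewrite !mul1n addn0 leq_max leq_addr.
have [u uU] : exists u, u \in U by apply/set0Pn; rewrite -card_gt0; lia.
case: (arg_maxnP (fun v => #|nbr g U v|) uU) => v0 v0U v0max.
have [dv|dv] := leqP (n - 4) #|nbr g U v0|.
  have n6 : 6 <= n by exact: leq_trans n_ge10.
  have := light_of_max_deg gsym girr n_ge10
    (fun v0 v1 v2 a b c => @Tpp_free_degree n p E n6 U v0 v1 v2 a b c girr freeE) v0U v0max dv.
  case/existsP => S /and4P[SU S0 Sn Sinc].
  have cUS : #|U :\: S| + #|S| = #|U| by rewrite -(cardsID S U) (setIidPr SU) addnC.
  have {}IH : (degsum g (U :\: S))./2
      <= turan_value n (#|U :\: S| %/ (n - 1)) (#|U :\: S| %% (n - 1)).
    apply: IH; [|exact: divn_eq|by rewrite ltn_mod; lia].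
    by move: Um S0 cUS; clear; lia.
  rewrite (degsumD gsym SU).
  apply: (@leq_trans ((degsum g (U :\: S))./2 + 'C(#|S|, 2))).
    by rewrite bin2_mul in Sinc; move: Sinc; move: (inc _ _ _) (degsum _ _) 'C(_, _); clear; lia.
  apply: leq_trans (leq_add IH (leqnn _)) _.
  apply: turan_value_add => //; last by rewrite -divn_eq cUS.
    by move: Sn; clear; lia.
  by rewrite ltn_mod; move: n_ge10; clear; lia.
have {}degU : degsum g U <= #|U| * (n - 5).
  by rewrite -sum_nat_const; apply: leq_sum => v /v0max; lia.
case: k cU => [|k] cU; first by lia.
rewrite /turan_value leq_max; apply/orP; right.
(* All but n - 1 + r vertices form [k] blocks of n - 1, each charged C(n - 1, 2); the others are
   charged n - 5 each. *)
have CM : (n - 1) * (n - 5) <= 2 * 'C(n - 1, 2).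
  have := bin2_sq (n - 1); move: 'C(_, 2) => c; move: n_ge10; clear.
  nia.
have kC : k * ((n - 1) * (n - 5)) <= 2 * (k * 'C(n - 1, 2)).
  by rewrite (mulnCA 2) leq_mul2l CM orbT.
have E1 : (k.+1 * (n - 1) + r) * (n - 5)
    = k * ((n - 1) * (n - 5)) + (n - 5) * (n - 1 + r).
  by move: (n - 1) (n - 5); clear; nia.
move: degU kC; rewrite cU E1.
move: (k * ((n - 1) * (n - 5))) (k * 'C(n - 1, 2)) ((n - 5) * (n - 1 + r)).
by move: (degsum _ _); clear; lia.
Qed.

Lemma edges_upper k r : p = k * (n - 1) + r -> r < n - 1 -> #|E| <= turan_value n k r.
Proof.
move=> pE rn; have E2 : degsum g setT = #|E|.*2.
  rewrite -mul2n -sum_degree //; apply: eq_big => [v|v _]; first by rewrite inE.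
  by rewrite nbr_degree.
have := @degsum_upper setT k r; rewrite cardsT card_ord => /(_ pE rn).
by rewrite E2 doubleK.
Qed.

End UpperBound.

(** * Lower bound *)

Definition attains n p x := exists E : {set {set 'I_p}},
  [/\ simple_graph E, ~~ contains_copy (Tpp n) E & x <= #|E|].

Lemma attains_ex n p x : attains n p x -> x <= ex p (Tpp n).
Proof.
case=> E [sE fE xE]; apply: leq_trans xE _.
by apply: (@leq_bigmax_cond _ _ (fun E : {set {set 'I_p}} => #|E|)); rewrite sE.
Qed.

Lemma attains_complete n p : p < n -> attains n p 'C(p, 2).
Proof.
move=> pn; exists [set e : {set 'I_p} | #|e| == 2]; split.
- by apply/forall_inP=> e; rewrite inE.
- apply/negP => /existsP[f /andP[/injectiveP injf _]].
  by have := leq_card f injf; rewrite !card_ord leqNgt pn.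
- by rewrite card_draws card_ord.
Qed.

Section Copies.
Variable n : nat.
Hypothesis n_ge6 : 6 <= n.

(** Connectedness of T_n'' in the form that confines a copy to one part of a disjoint union. *)
Lemma Tpp_connected (P : pred 'I_n) :
  (forall i j : 'I_n, Tpp_edge n i j -> P i = P j) -> forall i j, P i = P j.
Proof.
move=> Pe; have n0 : 0 < n by lia.
have n1 : 1 < n by lia.
have n2 : 2 < n by lia.
suff P0 i : P i = P (Ordinal n0) by move=> i j; rewrite !P0.
have P1 : P (Ordinal n0) = P (Ordinal n1) by apply: Pe; rewrite /Tpp_edge /=; lia.
have P2 : P (Ordinal n0) = P (Ordinal n2) by apply: Pe; rewrite /Tpp_edge /=; lia.
have [i0|[i1|[i2|i3]]] : i = 0 :> nat \/ 0 < i <= n - 4 \/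
    (i == n - 3 :> nat) || (i == n - 2 :> nat) \/ i == n - 1 :> nat.
- by have := ltn_ord i; lia.
- by congr P; apply: val_inj.
- by symmetry; apply: Pe; rewrite /Tpp_edge /= i1.
- by symmetry; rewrite P1; apply: Pe; rewrite /Tpp_edge /= i2.
- by symmetry; rewrite P2; apply: Pe; rewrite /Tpp_edge /= i3.
Qed.

(** The empty set is excluded because both injections into a disjoint union send it to the empty
    set, so its image does not reveal the part. *)
Lemma copy_preim a c (phi : 'I_a -> 'I_c) (A : {set {set 'I_a}}) (E : {set {set 'I_c}})
    (f : {ffun 'I_n -> 'I_c}) :
  injective f -> (forall i, f i \in codom phi) ->
  (forall e, e != set0 -> phi @: e \in E -> e \in A) ->
  (forall e, e \in Tpp n -> f @: e \in E) -> contains_copy (Tpp n) A.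
Proof.
move=> injf fphi EA fE; apply/existsP; exists [ffun i => iinv (fphi i)].
apply/andP; split.
  apply/injectiveP => i j; rewrite !ffunE => /(congr1 phi).
  by rewrite !f_iinv => /injf.
apply/forall_inP => e eT; apply: EA.
  case/TppP: eT => i [j [-> _]]; rewrite imset_set2.
  by apply/set0Pn; eexists; apply: set21.
rewrite -imset_comp (eq_imset (g := f)) ?fE // => i /=.
by rewrite ffunE f_iinv.
Qed.

Lemma attains_add a b x y : attains n a x -> attains n b y -> attains n (a + b) (x + y).
Proof.
case=> A [sA fA xA] [B [sB fB yB]].
have injl := @lshift_inj a b; have injr := @rshift_inj a b.
pose L := (fun e : {set 'I_a} => [set lshift b i | i in e]).
pose R := (fun e : {set 'I_b} => [set rshift a i | i in e]).
have LR (e : {set 'I_a}) e' : e != set0 -> L e != R e'.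
  case/set0Pn => i ie; apply/eqP => /setP/(_ (lshift b i)).
  rewrite imset_f // => /esym/imsetP[j _] /eqP.
  by rewrite eq_lrshift.
have RL (e : {set 'I_b}) e' : e != set0 -> R e != L e'.
  case/set0Pn => i ie; apply/eqP => /setP/(_ (rshift a i)).
  rewrite imset_f // => /esym/imsetP[j _] /eqP.
  by rewrite eq_rlshift.
have ne (T : finType) (C : {set T}) : #|C| == 2 -> C != set0.
  by rewrite -card_gt0 => /eqP->.
exists (L @: A :|: R @: B); split.
- apply/forall_inP => e; rewrite in_setU => /orP[] /imsetP[e' e'A ->].
    by rewrite card_imset //; apply: (forall_inP sA).
  by rewrite card_imset //; apply: (forall_inP sB).
- apply/negP => /existsP[f /andP[/injectiveP injf /forall_inP fE]].
  pose P i := f i \in codom (lshift b : 'I_a -> _).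
  have Pe (i j : 'I_n) : Tpp_edge n i j -> P i = P j.
    move=> ij; have : [set i; j] \in Tpp n by apply/TppP; exists i, j.
    move/fE; rewrite imset_set2 in_setU => /orP[] /imsetP[e _ eE].
      have /imsetP[i' _ iE] : f i \in L e by rewrite -eE set21.
      have /imsetP[j' _ jE] : f j \in L e by rewrite -eE set22.
      by rewrite /P iE jE !codom_f.
    have /imsetP[i' _ iE] : f i \in R e by rewrite -eE set21.
    have /imsetP[j' _ jE] : f j \in R e by rewrite -eE set22.
    rewrite /P iE jE; transitivity false; last symmetry.
      by apply/negP => /codomP[z /eqP]; rewrite eq_rlshift.
    by apply/negP => /codomP[z /eqP]; rewrite eq_rlshift.
  have PP := Tpp_connected Pe.
  have n0 : 0 < n by lia.
  case P0: (P (Ordinal n0)).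
    case/negP: fA; apply: (copy_preim (phi := lshift b) injf _ _ fE).
      by move=> i; rewrite -/(P i) (PP i (Ordinal n0)).
    move=> e e0; rewrite in_setU => /orP[] /imsetP[e' e'A /eqP].
      by move/eqP/(imset_inj injl) ->.
    by rewrite (negbTE (LR _ _ e0)).
  case/negP: fB; apply: (copy_preim (phi := @rshift a b) injf _ _ fE).
    move=> i; have := PP i (Ordinal n0); rewrite P0 /P.
    case: (split_ordP (f i)) => j -> //; first by rewrite codom_f.
    by rewrite codom_f.
  move=> e e0; rewrite in_setU => /orP[] /imsetP[e' e'A /eqP].
    by rewrite (negbTE (RL _ _ e0)).
  by move/eqP/(imset_inj injr) ->.
- have dLR : [disjoint L @: A & R @: B].
    rewrite -setI_eq0; apply/eqP/setP=> e; rewrite in_setI in_set0.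
    apply/andP => -[/imsetP[e1 e1A ->] /imsetP[e2 _ /eqP]].
    by rewrite (negbTE (LR _ _ (ne _ _ (forall_inP sA e1 e1A)))).
  rewrite cardsU (disjoint_setI0 dLR) cards0 subn0 !card_imset ?leq_add //.
    exact: imset_inj.
  exact: imset_inj.
Qed.

Lemma degree_of_copy p (E : {set {set 'I_p}}) :
  simple_graph E -> contains_copy (Tpp n) E -> exists v, n - 4 <= degree E v.
Proof.
move=> sE /existsP[f /andP[/injectiveP injf /forall_inP fE]].
have n0 : 0 < n by lia.
have kn (k : 'I_(n - 4)) : k.+1 < n by have := ltn_ord k; lia.
exists (f (Ordinal n0)); rewrite -nbr_degree //.
rewrite -[X in X <= _]card_ord -(card_imset (f := fun k => f (Ordinal (kn k)))).
  apply/subset_leq_card/subsetP => _ /imsetP[k _ ->].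
  rewrite inE in_setT /edge_rel -imset_set2; apply: fE.
  apply/TppP; exists (Ordinal n0), (Ordinal (kn k)); split=> //.
  by have := ltn_ord k; rewrite /Tpp_edge /=; lia.
by move=> k l /injf [] /val_inj.
Qed.

End Copies.

(** The additive form avoids truncated subtraction. *)
Lemma degree_swap p (E : {set {set 'I_p}}) a b v :
  a \in E -> b \notin E ->
  degree (b |: (E :\ a)) v + (v \in a) = degree E v + (v \in b).
Proof.
move=> aE bE; rewrite !degreeE big_setU1 /=; last by rewrite in_setD1 negb_and bE orbT.
by rewrite [in RHS](big_setD1 a) //=; lia.
Qed.

(* Moving an edge [u w] from a vertex of excessive degree to [v w], where [v] has
   degree below [d], decreases the total excess over [d]. *)
Lemma almost_regular m d : d < m -> exists E : {set {set 'I_m}},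
  [/\ simple_graph E, #|E| = (d * m)./2 & forall v, degree E v <= d].
Proof.
move=> dm; pose ok (E : {set {set 'I_m}}) := simple_graph E && (#|E| == (d * m)./2).
pose excess E := \sum_(v : 'I_m) (degree E v - d).
have [|E0 E0s cE0] := @exists_subset_card _ [set e : {set 'I_m} | #|e| == 2] (d * m)./2.
  rewrite card_draws card_ord bin2; apply: half_leq.
  by rewrite mulnC leq_mul2l; apply/orP; right; lia.
have okE0 : ok E0.
  by rewrite /ok cE0 eqxx andbT; apply/forall_inP => e /(subsetP E0s); rewrite inE.
have [E /andP[sE /eqP cE] Emin] := arg_minnP excess okE0.
exists E; split=> // u; rewrite leqNgt; apply/negP => ud.
have sumE : \sum_v degree E v <= d * m.
  by rewrite sum_degree // cE; move: (d * m); clear; lia.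
(* The degrees average at most [d] and [u] is above, so some vertex is below. *)
have [v vd] : exists v, degree E v < d.
  apply/existsP; apply: contraLR sumE; rewrite negb_exists -ltnNge => /forallP dv.
  have -> : d * m = \sum_(v < m) d by rewrite sum_nat_const card_ord mulnC.
  rewrite (bigD1 u) //= [X in _ < X](bigD1 u) //= -addSn leq_add //.
  by apply: leq_sum => v _; rewrite leqNgt.
pose N := nbr (edge_rel E) setT; have cN x : #|N x| = degree E x by exact: nbr_degree.
(* [u] has more than [d] neighbours, while [v] and its neighbours number at most [d]. *)
have [w] : exists w, w \in N u :\: (v |: N v).
  apply/set0Pn; rewrite -card_gt0; have := card_leqD (N u) (v |: N v).
  rewrite cardsU1 !cN; move: ud vd (leq_b1 (v \notin N v)).
  by move: (nat_of_bool _) #|_|; clear; lia.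
rewrite !inE /= negb_or => /andP[/andP[wv vw] uw].
have wu : w != u by apply: contraTneq uw => ->; rewrite (edge_rel_irr sE).
have uv : u != v by apply: contraTneq vd => <-; rewrite -leqNgt ltnW.
have deg' := degree_swap _ uw vw.
set E' := _ |: _ in deg'.
have okE' : ok E'.
  apply/andP; split.
    apply/forall_inP => e; rewrite in_setU1 in_setD1 => /orP[/eqP->|/andP[_ eE]].
      by rewrite cards2 (eq_sym v) wv.
    exact: (forall_inP sE).
  rewrite cardsU1 in_setD1 negb_and vw orbT -cE [#|E|](cardsD1 [set u; w]).
  by rewrite (uw : [set u; w] \in E).
have := Emin _ okE'; apply/negP; rewrite -ltnNge /excess.
(* The strict drop is at [u]; [v] rises to at most [d] and so keeps excess 0, and [w] keeps its
   degree. *)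
rewrite (bigD1 u) //= [X in _ < X](bigD1 u) //= -addSn leq_add //.
  have := deg' u; rewrite !inE eqxx (negbTE uv) eq_sym (negbTE wu) /=.
  by move: ud; clear; lia.
apply: leq_sum => x xu; have := deg' x; rewrite !inE (negbTE xu) /=.
case: (eqVneq x w) => _; first by rewrite orbT; clear; lia.
by case: (eqVneq x v) => [->|_]; [move: vd; clear; lia|clear; lia].
Qed.

Lemma attains_almost_regular n p :
  6 <= n -> n - 4 <= p -> attains n p ((n - 5) * p)./2.
Proof.
move=> n6 np; have [|E [sE cE dE]] := @almost_regular p (n - 5); first by lia.
exists E; split; rewrite ?cE //; apply/negP => /(degree_of_copy n6 sE) [v].
by have := dE v; lia.
Qed.

Lemma attains_disjoint_complete n q x k : 6 <= n -> attains n q x ->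
  attains n (k * (n - 1) + q) (k * 'C(n - 1, 2) + x).
Proof.
move=> n6 qx; elim: k => [|k IH]; first by rewrite !mul0n !add0n.
rewrite !mulSn -!addnA; apply: attains_add => //.
by apply: attains_complete; lia.
Qed.

Lemma ex_Tpp n k r : 10 <= n -> 0 < k -> r < n - 1 ->
  ex (k * (n - 1) + r) (Tpp n) = turan_value n k r.
Proof.
move=> n10 k0 rn; have n6 : 6 <= n by exact: leq_trans n10.
apply/eqP; rewrite eqn_leq; apply/andP; split.
  by apply/bigmax_leqP => E /andP[sE fE]; apply: edges_upper.
rewrite /turan_value geq_max; apply/andP; split.
  apply/attains_ex/attains_disjoint_complete => //.
  by apply: attains_complete; lia.
case: k k0 => // k _; rewrite mulSnr -addnA.
apply/attains_ex/attains_disjoint_complete => //.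
by apply: attains_almost_regular => //; lia.
Qed.

Theorem theorem3p1 (p n k r : nat) :
  (10 <= n)%N -> (n <= p)%N -> (0 < k)%N ->
  p = (k * (n - 1) + r)%N -> (r <= n - 2)%N ->
  ((ex p (Tpp n))%:R : rat)%R =
    (((((n%:Z - 2) * p%:Z - r%:Z * (n%:Z - 1 - r%:Z))%R)%:~R : rat) / 2%:R
    + ((Num.max 0%Z (((r%:Z * (n%:Z - 4 - r%:Z) - 3 * (n%:Z - 1))%R %/ 2)%Z))%:~R : rat))%R.
Proof.
move=> n10 _ k0 -> rn; rewrite ex_Tpp //; last by lia.
case: k k0 => // k _; rewrite /turan_value.
have [M nE] : exists M, n = M.+1 by exists n.-1; lia.
have := bin2_sq (n - 1); have := bin2_sq r.
have M9 : 9 <= M by lia.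
rewrite nE subn1 /= => Er EM; clear nE n10 rn n p.
set A := k.+1 * 'C(M, 2) + 'C(r, 2).
(* The fraction in the formula is exactly the edge count [A] of the disjoint complete graphs, so its
   division by 2 leaves no remainder. *)
have EA : ((M.+1%:Z - 2) * (k.+1 * M + r)%N%:Z - r%:Z * (M.+1%:Z - 1 - r%:Z) = A%:Z * 2)%R.
  have := congr1 (muln k.+1) EM; rewrite /A; move: Er.
  by move: 'C(_, 2) 'C(_, 2); clear; nia.
set Y := (r%:Z * _ - _)%R; set B := k * _ + _.
(* Before halving, the two constructions differ by exactly [Y], which may be negative; integer
   division by 2 rounds down, as does the halving in [B]. *)
have EB : (B%:Z = A%:Z + (Y %/ 2)%Z)%R.
  have : ((((M.+1 - 5) * (M + r))%N)%:Z = 2 * ('C(M, 2)%:Z + 'C(r, 2)%:Z) + Y)%R.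
    have -> : M.+1 - 5 = M - 4 by lia.
    rewrite /Y; move: M9 Er EM; move: 'C(_, 2) 'C(_, 2); clear; nia.
  rewrite /A /B mulSn.
  move: (k * 'C(M, 2)) ((M.+1 - 5) * (M + r)) Y 'C(_, 2) 'C(_, 2); clear; lia.
rewrite EA intrM mulfK // -intrD pmulrn; congr (_%:~R)%R.
by clear EA; clearbody A B; move: EB; move: (Y %/ 2)%Z; clear; lia.
Qed.
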